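(* Let $(G,\cdot)$ be a CIPL and let $(H,\circ)$ be a loop isomorphic to $(G,\cdot)$. Then $(G,\cdot)$ and $(H,\circ)$ obey the weak $\mathcal{T}_{21}$ condition.
   Context: Maps are written on the right of their arguments and composed from left to right: $xAB=(xA)B$. A loop is a set with a binary operation for which $a\cdot x=b$ and $y\cdot a=b$ have unique solutions $x,y$ for all $a,b$, and which has a two-sided identity element $e$. For $x$ in a loop, $x^\rho$ and $x^\lambda$ denote the right and left inverses: $xx^\rho=e=x^\lambda x$. A loop is a cross inverse property loop (CIPL) if $xy\cdot x^\rho=y$ for all $x,y$. Let $J_\rho:x\mapsto x^\rho$ and $J_\lambda:x\mapsto x^\lambda$ be the right and left inverse mappings on $(G,\cdot)$, and $J_\rho',J_\lambda'$ those on $(H,\circ)$. The loops $(G,\cdot)$ and $(H,\circ)$ obey the weak $\mathcal{T}_{21}$ condition if and only if $J_\rho'=M^{-1}J_\rho M$ or $J_\lambda'=M^{-1}J_\lambda M$ for some bijection $M:G\to H$. *)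

(* Defs.v *)
From HB Require Import structures.
From mathcomp Require Import all_boot.
From mathcomp Require Import boolp.

Set Implicit Arguments.
Unset Strict Implicit.
Unset Printing Implicit Defensive.

Local Open Scope group_scope.

(* [umagmaType] is not used as the base because it also requires a choiceType
   structure; the carrier of a loop is an arbitrary type. *)
HB.mixin Record BaseUMagma_isLoop G of BaseUMagma G := {
  loop_mul1g : left_id 1 (@mul G);
  loop_mulg1 : right_id 1 (@mul G);
  loop_ldiv : forall a b : G, exists! x, a * x = b;
  loop_rdiv : forall a b : G, exists! y, y * a = b
}.

#[short(type="loopType")]
HB.structure Definition Loop := {G of BaseUMagma_isLoop G & BaseUMagma G}.

Definition J_rho (G : loopType) (x : G) : G := sval (cid (loop_ldiv x 1)).

Definition J_lambda (G : loopType) (x : G) : G := sval (cid (loop_rdiv x 1)).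

Lemma mulg_J_rho (G : loopType) (x : G) : x * J_rho x = 1.
Proof. by rewrite /J_rho; case: cid => y []. Qed.

Lemma mulg_J_lambda (G : loopType) (x : G) : J_lambda x * x = 1.
Proof. by rewrite /J_lambda; case: cid => y []. Qed.

Definition CIPL (G : loopType) : Prop :=
  forall x y : G, (x * y) * J_rho x = y.

Definition loop_isomorphic (G H : loopType) : Prop :=
  exists f : {multiplicative G -> H}, bijective f.

(* Maps act on the right (x(AB) = (xA)B), so the product ABC of maps is the
   diagrammatic composition [A \; B \; C]. *)
Definition weak_T21 (G H : loopType) : Prop :=
  exists (M : G -> H) (Minv : H -> G),
    [/\ cancel M Minv, cancel Minv M &
        @J_rho H =1 (Minv \; @J_rho G \; M) \/
        @J_lambda H =1 (Minv \; @J_lambda G \; M)].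

(* Main.v *)
Require Import Defs.
From mathcomp Require Import all_boot.

(** An isomorphism [f] itself serves as the bijection [M].  By unique left
    division, the right inverse of [x] is the only solution [y] of [x * y = 1],
    and a product-preserving map between loops also preserves [1]; hence [f]
    carries right inverses to right inverses, and conjugating [J_rho G] by [f]
    yields [J_rho H]. *)

Local Open Scope group_scope.

Lemma loop_mulgI (G : loopType) (a x y : G) : a * x = a * y -> x = y.
Proof. by move=> axy; have [z [_ zP]] := loop_ldiv a (a * y); rewrite -(zP x) // -(zP y). Qed.

Lemma J_rho_unique (G : loopType) (x y : G) : x * y = 1 -> y = J_rho x.
Proof. by move=> xy1; apply: (@loop_mulgI _ x); rewrite mulg_J_rho. Qed.

(** The image of [1] is idempotent, and cancellation makes [1] the only
    idempotent of a loop. *)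
Lemma loop_morph1 (G H : loopType) (f : {multiplicative G -> H}) : f 1 = 1.
Proof. by apply: (@loop_mulgI _ (f 1)); rewrite -gmulfM !loop_mulg1. Qed.

Lemma loop_morphJ_rho (G H : loopType) (f : {multiplicative G -> H}) (x : G) :
  f (J_rho x) = J_rho (f x).
Proof. by apply: J_rho_unique; rewrite -gmulfM mulg_J_rho loop_morph1. Qed.

Theorem corollary3p7 (G H : loopType) :
  CIPL G -> loop_isomorphic G H -> weak_T21 G H.
Proof.
move=> _ [f [g fK gK]]; exists f, g; split=> //; left=> h /=.
by rewrite loop_morphJ_rho gK.
Qed.
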